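(* For all integers $\ell\ge1$, $k\ge0$ and all $\zeta>0$, $$\frac{\partial P_{k+1}^{(\ell-1)}}{\partial x}=\frac{2\ell-1}{2\ell+1}\frac{k+1}{\tilde{p}_{k}^{(\ell)}}P_{k}^{(\ell)}+\zeta r_{k}^{(\ell)}P_{k-1}^{(\ell)},$$ $$\frac{2\ell-1}{2\ell+1}(x^2-1)\frac{\partial P_{k}^{(\ell)}}{\partial x}+(2\ell-1)xP_{k}^{(\ell)}=(k+2\ell+1)\tilde{p}_{k}^{(\ell)}P_{k+1}^{(\ell-1)}+\zeta p_{k}^{(\ell)} P_{k}^{(\ell-1)}.$$
   Context: For $\zeta>0$ and an integer $\ell\ge0$, $\omega^{(\ell)}(x;\zeta)=\frac{\zeta(x^2-1)^{\ell+1/2}}{(2\ell+1)K_{2}(\zeta)}e^{-\zeta x}$ on $[1,+\infty)$, where $K_\nu$ is the modified Bessel function of the second kind, and $(f,g)_{\omega^{(\ell)}}=\int_1^\infty fg\,\omega^{(\ell)}(x;\zeta)\,dx$. $\{P_k^{(\ell)}(x;\zeta)\}_{k\ge0}$ are the orthonormal polynomials for this inner product: $\deg P_k^{(\ell)}=k$, $(P_i^{(\ell)},P_k^{(\ell)})_{\omega^{(\ell)}}=\delta_{i,k}$, with leading coefficient $c_k^{(\ell)}>0$. For $\ell\ge1$: $p_{k}^{(\ell)}:=\frac{c_{k}^{(\ell-1)}}{c_{k}^{(\ell)}}$, $r_{k}^{(\ell)}:=\frac{2\ell-1}{2\ell+1}\frac{c_{k-1}^{(\ell)}}{c_{k+1}^{(\ell-1)}}$,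 $\tilde{p}_{k}^{(\ell)}:=\frac{2\ell-1}{2\ell+1}\frac{c_{k}^{(\ell)}}{c_{k+1}^{(\ell-1)}}$. Conventions: $P_{-1}^{(\ell)}=0$, $c_{-1}^{(\ell)}=0$. *)

(* Defs.v *)
From HB Require Import structures.
From mathcomp Require Import all_boot all_order all_algebra.
From mathcomp Require Import all_classical all_reals all_analysis.

Set Implicit Arguments.
Unset Strict Implicit.
Unset Printing Implicit Defensive.

Import Order.TTheory GRing.Theory Num.Theory.
Import numFieldNormedType.Exports.

Local Open Scope classical_set_scope.
Local Open Scope ring_scope.

Definition cosh (R : realType) (t : R) : R := (expR t + expR (- t)) / 2.

(* The modified Bessel function of the second kind, for z > 0, through its
   integral representation
     K_nu(z) = int_0^oo cosh(nu t) exp(- z cosh t) dt. *)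
Definition besselK (R : realType) (nu z : R) : R :=
  Rintegral lebesgue_measure `[0, +oo[
    (fun t : R => cosh (nu * t) * expR (- (z * cosh t))).

Definition omega (R : realType) (zeta : R) (l : nat) (x : R) : R :=
  zeta * (x ^+ 2 - 1) `^ (l%:R + 2^-1)
    / ((2 * l%:R + 1) * besselK 2 zeta) * expR (- (zeta * x)).

Definition inner_omega (R : realType) (zeta : R) (l : nat) (f g : R -> R) : R :=
  Rintegral lebesgue_measure `[1, +oo[
    (fun x : R => f x * g x * omega zeta l x).

(* These three conditions determine the family uniquely. *)
Definition orthonormal_polys (R : realType) (zeta : R) (l : nat)
    (P : nat -> {poly R}) : Prop :=
  [/\ forall k, size (P k) = k.+1,
      forall k, 0 < lead_coef (P k)
    & forall i k, inner_omega zeta l (horner (P i)) (horner (P k))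
                  = (i == k)%:R].

(* prev_poly P k is the polynomial of index k - 1, with P_(-1) = 0; since
   lead_coef 0 = 0, its leading coefficient obeys the convention c_(-1) = 0. *)
Definition prev_poly (R : realType) (P : nat -> {poly R}) (k : nat) : {poly R} :=
  if k is k'.+1 then P k' else 0.

(* In the coefficients below P l k stands for P_k^(l), and l is meant to be
   at least 1, so that l.-1 is the true predecessor. *)
Definition p_coef (R : realType) (P : nat -> nat -> {poly R}) (l k : nat) : R :=
  lead_coef (P l.-1 k) / lead_coef (P l k).

Definition r_coef (R : realType) (P : nat -> nat -> {poly R}) (l k : nat) : R :=
  (2 * l%:R - 1) / (2 * l%:R + 1)
  * (lead_coef (prev_poly (P l) k) / lead_coef (P l.-1 k.+1)).

Definition pt_coef (R : realType) (P : nat -> nat -> {poly R}) (l k : nat) : R :=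
  (2 * l%:R - 1) / (2 * l%:R + 1)
  * (lead_coef (P l k) / lead_coef (P l.-1 k.+1)).

(* Main.v *)
Require Import Defs.
From HB Require Import structures.
From mathcomp Require Import all_boot all_order all_algebra.
From mathcomp Require Import all_classical all_reals all_analysis measurable_realfun.
From mathcomp Require Import ring lra.

(** Write [T = X^2 - 1], let [J f] be the integral over [1, +oo) of
    [f(x) sqrt(x^2 - 1) exp(- zeta x)], and let [U_l f] be the integral of
    [f omega^(l)].  On [1, +oo) the half-integer power splits as
    [(x^2 - 1)^(l + 1/2) = (x^2 - 1)^l sqrt(x^2 - 1)], so that
    [U_l f = A_l J (T^l f)] for a constant [A_l]: the whole hierarchy of
    weights is governed by the single functional [J] on polynomials.

    The derivative of [T p sqrt(x^2 - 1) exp(- zeta x)] is again a polynomial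
    times [sqrt(x^2 - 1) exp(- zeta x)], and that product vanishes at 1 and at
    infinity.  Integrating it gives the Pearson relation
    [J ((T p)') + J (X p) = zeta J (T p)] (bessel_scalar_pearson).  Since
    [(2l + 1) A_l = (2l - 1) A_(l-1)], it becomes, for [l >= 1],
    - [U_l f = (2l - 1) / (2l + 1) U_(l-1) (T f)]
      (omega_functional_mulX2B1), and
    - [U_l (f') = zeta U_l f - (2l - 1) U_(l-1) (X f)]
      (omega_functional_deriv).

    The rest is linear algebra.  A polynomial of degree at most [n] is
    determined by its pairings with the first [n + 1] orthonormal polynomials
    (orthonormal_ext), and the pairing of [q] with [P_k], when [deg q <= k], is
    the coefficient of [q] at [k] over the leading coefficient of [P_k]
    (orthonormal_coef).  The two relations move the derivative off
    [P_(k+1)^(l-1)] or [P_k^(l)]; a degree count then kills all pairings except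
    two, which are read off from leading coefficients (deriv_ladder and
    weighted_deriv_ladder). *)

Set Implicit Arguments.
Unset Strict Implicit.
Unset Printing Implicit Defensive.

Import Order.TTheory GRing.Theory Num.Theory.
Import numFieldNormedType.Exports.
Local Open Scope ring_scope.

(** * Orthonormal families of polynomials for a linear functional *)

Section Orthonormal.
Context {F : fieldType}.
Implicit Types (U : {scalar {poly F}}) (p : nat -> {poly F}) (q : {poly F}).

Definition orthonormal U p :=
  (forall k, size (p k) = k.+1) /\ (forall i k, U (p i * p k) = (i == k)%:R).

Lemma size_drop_lead n q p : size (p n) = n.+1 -> (size q <= n.+1)%N ->
  (size (q - (q`_n / lead_coef (p n)) *: p n)%R <= n)%N.
Proof.
move=> sp sq.
have c0 : lead_coef (p n) != 0 by rewrite lead_coef_eq0 -size_poly_gt0 sp.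
apply/leq_sizeP => j; rewrite leq_eqVlt coefB coefZ => /predU1P[<-|nj].
  by rewrite -[X in _ * X]/((p n)`_(n.+1.-1)) -sp -lead_coefE divfK// subrr.
rewrite [q`_j]nth_default ?(leq_trans sq)// [(p n)`_j]nth_default ?sp//.
by rewrite mulr0 subr0.
Qed.

Section Family.
Context {U : {scalar {poly F}}} {p : nat -> {poly F}}.
Hypothesis onp : orthonormal U p.

Lemma lead_coef_orthonormal_neq0 k : lead_coef (p k) != 0.
Proof. by rewrite lead_coef_eq0 -size_poly_gt0 onp.1. Qed.

(** [q] lies in the span of the [p j] with [j < n], so it pairs to zero with
    every later member of the family; the induction peels off the term of
    index [n]. *)
Lemma orthonormal_low k n q :
  (n <= k)%N -> (size q <= n)%N -> U (p k * q) = 0.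
Proof.
elim: n q => [|n IHn] q nk sq.
  by move: sq; rewrite leqn0 size_poly_eq0 => /eqP->; rewrite mulr0 linear0.
rewrite -[q](subrK ((q`_n / lead_coef (p n)) *: p n)) mulrDr linearD.
rewrite IHn ?(ltnW nk) ?size_drop_lead ?onp.1// add0r -scalerAr linearZ /=.
by rewrite onp.2 gtn_eqF// mulr0.
Qed.

(** Only the component of [q] along [p k] survives the pairing, and comparing
    leading terms gives its coefficient. *)
Lemma orthonormal_coef k q : (size q <= k.+1)%N ->
  U (p k * q) = q`_k / lead_coef (p k).
Proof.
move=> sq; rewrite -[q in LHS](subrK ((q`_k / lead_coef (p k)) *: p k)).
rewrite mulrDr linearD (@orthonormal_low k k) ?size_drop_lead ?onp.1//.
by rewrite add0r -scalerAr linearZ /= onp.2 eqxx mulr1.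
Qed.

(** The top pairing of the difference is its top coefficient up to a nonzero
    factor, so the degree drops step by step until nothing is left. *)
Lemma orthonormal_ext n q1 q2 : (size q1 <= n)%N -> (size q2 <= n)%N ->
  (forall j, (j < n)%N -> U (p j * q1) = U (p j * q2)) -> q1 = q2.
Proof.
move=> s1 s2 E; apply/eqP; rewrite -subr_eq0; apply/eqP.
have : (size (q1 - q2)%R <= n)%N.
  by rewrite (leq_trans (size_polyD _ _))// size_polyN geq_max s1.
have : forall j, (j < n)%N -> U (p j * (q1 - q2)) = 0.
  by move=> j jn; rewrite mulrBr linearB /= E// subrr.
elim: n (q1 - q2) {s1 s2 E} => [|n IHn] q Uq sq.
  by apply/eqP; rewrite -size_poly_eq0 -leqn0.
apply: IHn => [j jn|]; first by rewrite Uq// ltnW.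
have /eqP := Uq n (leqnn _); rewrite orthonormal_coef// mulf_eq0 invr_eq0.
rewrite (negbTE (lead_coef_orthonormal_neq0 n)) orbF => /eqP qn.
by move: (size_drop_lead (onp.1 n) sq); rewrite qn mul0r scale0r subr0.
Qed.

Lemma orthonormal_comb m (i j : nat) (al be : F) :
  U (p m * (al *: p i + be *: p j)) = al * (m == i)%:R + be * (m == j)%:R.
Proof. by rewrite mulrDr -!scalerAr linearD !linearZ /= !onp.2. Qed.

End Family.
End Orthonormal.

(** * Derivative relations between two adjacent orthonormal families *)

Definition pred_family (F : nzRingType) (p : nat -> {poly F}) k : {poly F} :=
  if k is k'.+1 then p k' else 0.

Section Ladder.
Context {F : fieldType}.
(* For the weights omega^(l-1) and omega^(l): b = 2 l - 1 and c = 2 l + 1. *)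
Variables (zeta b c : F) (U0 U1 : {scalar {poly F}}).
Hypothesis U1_mulX2B1 : forall f, U1 f = b / c * U0 (('X^2 - 1) * f).
Hypothesis U1_deriv : forall f, U1 f^`() = zeta * U1 f - b * U0 ('X * f).
Variables p0 p1 : nat -> {poly F}.
Hypotheses (on0 : orthonormal U0 p0) (on1 : orthonormal U1 p1).

Local Notation c0 k := (lead_coef (p0 k)).
Local Notation c1 k := (lead_coef (p1 k)).

Let coef_lead0 k : (p0 k)`_k = c0 k. Proof. by rewrite lead_coefE on0.1. Qed.
Let coef_lead1 k : (p1 k)`_k = c1 k. Proof. by rewrite lead_coefE on1.1. Qed.

Local Notation prev k := (pred_family p1 k).

Lemma coef_X2B1M (q : {poly F}) k :
  (('X^2 - 1) * q)`_k.+2 = q`_k - q`_k.+2.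
Proof. by rewrite mulrBl mul1r coefB coefXnM /= subn2. Qed.

Lemma size_X2B1M (q : {poly F}) n :
  (size q <= n)%N -> (size (('X^2 - 1) * q)%R <= n.+2)%N.
Proof.
move=> sq; rewrite (leq_trans (size_polyMleq _ _))//.
have s : (size ('X^2 - 1 : {poly F})%R <= 3)%N by rewrite size_XnsubC.
by rewrite -subn1 leq_subLR -[(1 + _)%N]/(3 + n)%N leq_add.
Qed.

Lemma size_deriv_le (q : {poly F}) n :
  (size q <= n.+1)%N -> (size q^`() <= n)%N.
Proof. by move=> sq; rewrite (leq_trans (size_poly _ _))//; case: size sq. Qed.

Lemma size_XM (q : {poly F}) n :
  (size q <= n)%N -> (size ('X * q)%R <= n.+1)%N.
Proof.
move=> sq; rewrite mulrC; have [->|q0] := eqVneq q 0.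
  by rewrite mul0r size_poly0.
by rewrite size_mulX.
Qed.

(** Integration by parts, with the result expressed through [U0] alone, for
    which [g] will be taken orthogonal to the lower degrees. *)
Lemma U1_mul_deriv (q g : {poly F}) :
  U1 (q * g^`()) = b / c * U0 (g * (('X^2 - 1) * (zeta *: q - q^`())))
    - b * U0 (g * ('X * q)).
Proof.
have : U1 (q * g)^`() = U1 (q^`() * g) + U1 (q * g^`()) by rewrite derivM linearD.
rewrite U1_deriv !U1_mulX2B1 => /esym/(canRL (addKr _)) ->.
have -> : g * (('X^2 - 1) * (zeta *: q - q^`())) =
   zeta *: (('X^2 - 1) * (q * g)) - ('X^2 - 1) * (q^`() * g).
  rewrite -!mul_polyC; ring.
rewrite linearB linearZ /=.
have -> : g * ('X * q) = 'X * (q * g) by ring.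
ring.
Qed.

(** Pairing with [p1 j] for [j < k] puts [p0 k.+1] against polynomials of degree
    at most [j + 2], so that only [j = k - 1] contributes; [j = k] compares
    leading coefficients. *)
Lemma deriv_ladder k :
  (p0 k.+1)^`() = (k.+1%:R * c0 k.+1 / c1 k) *: p1 k
    + (zeta * (b / c * (lead_coef (prev k) / c0 k.+1))) *: prev k.
Proof.
have sD : (size (p0 k.+1)^`() <= k.+1)%N by rewrite size_deriv_le// on0.1.
apply: (orthonormal_ext on1 sD).
  rewrite (leq_trans (size_polyD _ _))// geq_max !(leq_trans (size_scale_leq _ _))//.
    by case: (k) => [|k'] /=; rewrite ?size_poly0 ?on1.1.
  by rewrite on1.1.
move=> j; rewrite ltnS leq_eqVlt => /predU1P[->|jk].
  rewrite (orthonormal_coef on1 sD) coef_deriv coef_lead0.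
  rewrite mulrDr -!scalerAr linearD !linearZ /= on1.2 eqxx mulr1.
  suff -> : U1 (p1 k * prev k) = 0 by rewrite mulr0 addr0 mulr_natl.
  by case: (k) => [|k'] /=; rewrite ?mulr0 ?linear0// on1.2 gtn_eqF.
have sj : size (p1 j) = j.+1 := on1.1 j.
rewrite U1_mul_deriv [X in _ - _ * X](orthonormal_low on0 (leqnn _)); last first.
  by rewrite size_XM// sj.
case: k jk sD => // k jk _.
rewrite mulr0 subr0 (orthonormal_coef on0); last first.
  rewrite size_X2B1M// (leq_trans (size_polyD _ _))// size_polyN geq_max.
  rewrite (leq_trans (size_scale_leq _ _)) ?sj//.
  by rewrite size_deriv_le// sj ltnW.
rewrite coef_X2B1M !coefB !coefZ !coef_deriv.
have coef_gt i : (j < i)%N -> (p1 j)`_i = 0.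
  by move=> ji; rewrite nth_default ?sj.
rewrite (coef_gt k.+1)// (coef_gt k.+2) 1?ltnW// (coef_gt k.+3) 1?ltnW 1?ltnW//.
rewrite !mul0rn mulr0 !subr0 /= (orthonormal_comb on1).
rewrite [j == k.+1]ltn_eqF// mulr0 add0r.
move: jk; rewrite ltnS leq_eqVlt => /predU1P[->|jk].
  rewrite coef_lead1 eqxx mulr1; ring.
by rewrite ltn_eqF// coef_gt// !(mulr0, mul0r).
Qed.

Hypothesis c_neq0 : c != 0.

(** The left-hand side is adjoint to differentiation: pairing it under [U0] with
    [q] gives [zeta U1 (p1 k * q) - U1 (p1 k * q')], which vanishes when [q] has
    degree below [k]. *)
Lemma weighted_deriv_ladder k :
  (b / c) *: (('X^2 - 1) * (p1 k)^`()) + b *: ('X * p1 k)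
  = ((k%:R + c) * (b / c * (c1 k / c0 k.+1))) *: p0 k.+1
    + (zeta * (c0 k / c1 k)) *: p0 k.
Proof.
have sk : size (p1 k) = k.+1 := on1.1 k.
set G := LHS.
have sG : (size G <= k.+2)%N.
  rewrite (leq_trans (size_polyD _ _))// geq_max !(leq_trans (size_scale_leq _ _))//.
    by rewrite size_XM// sk.
  by rewrite size_X2B1M// size_deriv_le// sk.
apply: (orthonormal_ext on0 sG).
  rewrite (leq_trans (size_polyD _ _))// geq_max !(leq_trans (size_scale_leq _ _))//.
    by rewrite on0.1.
  by rewrite on0.1.
move=> j; rewrite ltnS leq_eqVlt (orthonormal_comb on0) => /predU1P[->|jk].
  rewrite (orthonormal_coef on0 sG) eqxx gtn_eqF// mulr0 addr0 mulr1.
  rewrite !mulrA; congr (_ / _).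
  rewrite coefD !coefZ coefXM /= coef_lead1.
  have -> : (('X^2 - 1) * (p1 k)^`())`_k.+1 = k%:R * c1 k.
    rewrite mulr_natl -coef_lead1; case: (k) sk => [|k'] sk.
      by rewrite mulrBl mul1r coefB coefXnM /= coef_deriv nth_default ?sk// mul0rn subrr.
    by rewrite coef_X2B1M !coef_deriv [X in _ - X *+ _]nth_default ?sk// mul0rn subr0.
  by field.
have sj : size (p0 j) = j.+1 := on0.1 j.
rewrite ltn_eqF// mulr0 add0r.
(* Integration by parts, moving the derivative from p1 k to p0 j. *)
have -> : U0 (p0 j * G) = zeta * U1 (p1 k * p0 j) - U1 (p1 k * (p0 j)^`()).
  have -> : p0 j * G = (b / c) *: (('X^2 - 1) * (p0 j * (p1 k)^`()))
     + b *: ('X * (p0 j * p1 k)) by rewrite /G -!mul_polyC; ring.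
  rewrite linearD !linearZ /= -U1_mulX2B1.
  have := U1_deriv (p0 j * p1 k); rewrite derivM linearD /=.
  rewrite [p1 k * p0 j]mulrC [p1 k * _^`()]mulrC => /(canRL (addKr _)) ->; ring.
rewrite (orthonormal_coef on1) ?sj//.
rewrite (orthonormal_low on1 (leqnn k)) ?size_deriv_le ?sj// subr0.
move: jk; rewrite ltnS leq_eqVlt => /predU1P[->|jk].
  by rewrite eqxx mulr1 coef_lead0.
by rewrite ltn_eqF// nth_default ?sj// !(mul0r, mulr0).
Qed.

End Ladder.

(** * Improper integrals under an exponential bound *)

Section ExponentialDecay.
Local Open Scope classical_set_scope.
Local Open Scope ring_scope.
Context {R : realType}.
Implicit Types (a b C x : R) (f F : R -> R).
Local Notation mu := (@lebesgue_measure R).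

Definition expdecay C b x : R := C * expR (- (b * x)).

Lemma is_derive_expdecay C b x :
  is_derive x 1 (expdecay C b) (expdecay (- (C * b)) b x).
Proof.
have -> : expdecay C b = C \*: (expR \o (- b \*: @id R)).
  by apply/funext => t; rewrite /expdecay /= -mulNr.
have D : is_derive x 1 (- b \*: @id R) (- b *: 1) by apply: is_deriveZ.
have D2 := is_deriveZ C (is_derive1_comp (is_derive_expR ((- b \*: @id R) x)) D).
apply: is_derive_eq D2 _.
rewrite /expdecay /= /GRing.scale /= mulr1 mulNr; ring.
Qed.

Lemma continuous_expdecay C b : continuous (expdecay C b).
Proof.
move=> x; apply/differentiable_continuous/derivable1_diffP.
by have [] := is_derive_expdecay C b x.
Qed.

Lemma cvg_expdecay C b : 0 < b -> expdecay C b x @[x --> +oo%R] --> (0 : R).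
Proof.
move=> b0; rewrite -[X in _ --> X](mulr0 C).
apply: cvgM; first exact: cvg_cst.
apply: (@cvg_comp _ _ _ (fun x => b * x) (fun z => expR (- z)) _ (pinfty_nbhs R)).
  exact: gt0_cvgMry.
exact: cvgr_expR.
Qed.

Lemma integral_expdecay C b a : 0 < b -> 0 <= C ->
  (\int[mu]_(x in `[a, +oo[) (expdecay C b x)%:E
    = (expdecay (C / b) b a)%:E)%E.
Proof.
move=> b0 C0.
rewrite (@ge0_continuous_FTC2y _ _ (expdecay (- (C / b)) b) _ 0).
- by rewrite sub0e -EFinN /expdecay mulNr opprK.
- by move=> x _; rewrite mulr_ge0// expR_ge0.
- exact/continuous_subspaceT/continuous_expdecay.
- exact: cvg_expdecay.
- by move=> x _; have [] := is_derive_expdecay (- (C / b)) b x.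
- exact/cvg_at_right_filter/continuous_expdecay.
- move=> x _; rewrite derive1E.
  have D := is_derive_expdecay (- (C / b)) b x.
  by rewrite derive_val mulNr opprK divfK// gt_eqF.
Qed.

Lemma integrable_expdecay C b a : 0 < b -> 0 <= C ->
  mu.-integrable `[a, +oo[ (EFin \o expdecay C b).
Proof.
move=> b0 C0; apply/integrableP; split.
  apply/measurable_EFinP/measurable_funTS.
  apply: continuous_measurable_fun; exact: continuous_expdecay.
under eq_integral do rewrite /= ger0_norm ?mulr_ge0 ?expR_ge0//.
by rewrite (integral_expdecay a b0 C0) ltry.
Qed.

Lemma bound_expdecay_ge0 f a b C :
  (forall x, a <= x -> `|f x| <= expdecay C b x) -> 0 <= C.
Proof.
move=> /(_ a (lexx a)) /(le_trans (normr_ge0 _)).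
by rewrite pmulr_lge0// expR_gt0.
Qed.

Lemma integrable_le_expdecay f a b C : 0 < b -> continuous f ->
  (forall x, a <= x -> `|f x| <= expdecay C b x) ->
  mu.-integrable `[a, +oo[ (EFin \o f).
Proof.
move=> b0 cf fle.
have C0 := bound_expdecay_ge0 fle.
apply: (le_integrable _ _ _ (integrable_expdecay a b0 C0)) => //.
  by apply/measurable_EFinP/measurable_funTS; apply: continuous_measurable_fun.
move=> x /=; rewrite in_itv/= andbT => ax.
by rewrite lee_fin (le_trans (fle x ax))// ler_norm.
Qed.

(** For a nonnegative derivative, the fundamental theorem of calculus passes to
    a half-line by monotone convergence.  Adding the dominating exponential to
    [f], and its primitive to [F], reduces the signed case to that one; the
    integral of the exponential is then subtracted. *)
Lemma Rintegral_derive_le_expdecay f F a b C : 0 < b ->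
  continuous f -> continuous F ->
  (forall x, a < x -> is_derive x 1 F (f x)) ->
  (forall x, a <= x -> `|f x| <= expdecay C b x) ->
  F x @[x --> +oo%R] --> (0 : R) ->
  \int[mu]_(x in `[a, +oo[) f x = - F a.
Proof.
move=> b0 cf cF dF fle F0.
have C0 := bound_expdecay_ge0 fle.
have intf := integrable_le_expdecay b0 cf fle.
have inth := integrable_expdecay a b0 C0.
set h := expdecay C b in fle inth *.
pose H := expdecay (- (C / b)) b.
have dH x : is_derive x 1 H (h x).
  apply: is_derive_eq (is_derive_expdecay _ _ _) _.
  by rewrite mulNr opprK divfK// gt_eqF.
have dFH x : a < x -> is_derive x 1 (F + H) (f x + h x).
  by move=> ax; have := dF x ax => dFx; apply: is_deriveD.
have : \int[mu]_(x in `[a, +oo[) (f x + h x) = 0 - (F + H) a.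
  apply: Rintegral_ge0_continuous_FTC2y.
  - by move=> x ax; have := fle x ax; rewrite ler_norml => /andP[]; lra.
  - apply/continuous_subspaceT => x; apply: cvgD; first exact: cf.
    exact: continuous_expdecay.
  - by rewrite -[X in _ --> X]addr0; apply: cvgD => //; exact: cvg_expdecay.
  - by move=> x ax; have [] := dFH x ax.
  - apply: cvg_at_right_filter; apply: cvgD; first exact: cF.
    exact: continuous_expdecay.
  - move=> x; rewrite in_itv/= andbT => ax; rewrite derive1E.
    by have D := dFH x ax; rewrite derive_val.
rewrite RintegralD//.
have -> : \int[mu]_(x in `[a, +oo[) h x = - H a.
  by rewrite /Rintegral integral_expdecay//= /H /expdecay mulNr opprK.
rewrite sub0r => /(canRL (subrK _)) ->.
by rewrite [(F + H) a]/(F a + H a) opprD subrK.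
Qed.

(** The right-hand side is at least the term of index [n] of the exponential
    series, rescaled. *)
Lemma exprn_le_expR n b x : 0 < b -> 0 <= x ->
  x ^+ n <= n`!%:R / b ^+ n * expR (b * x).
Proof.
move=> b0 x0.
have bx : 0 <= b * x by rewrite mulr_ge0// ltW.
have : (b * x) ^+ n <= n`!%:R * expR (b * x).
  case: n => [|n]; first by rewrite expr0 fact0 mul1r -[X in X <= _]expR0 ler_expR.
  rewrite [leRHS]mulrC -ler_pdivrMr ?ltr0n ?fact_gt0//.
  by apply: le_trans (expR_ge1Dxn n bx); rewrite lerDr.
by rewrite mulrAC ler_pdivlMr ?exprn_gt0// -exprMn [x * b]mulrC.
Qed.

Lemma horner_le_expR (p : {poly R}) b : 0 < b ->
  exists C, forall x, 0 <= x -> `|p.[x]| <= C * expR (b * x).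
Proof.
move=> b0; exists (\sum_(i < size p) `|p`_i| * (i`!%:R / b ^+ i)) => x x0.
rewrite horner_coef mulr_suml (le_trans (ler_norm_sum _ _ _))//.
apply: ler_sum => i _; rewrite normrM -mulrA ler_wpM2l//.
by rewrite ger0_norm ?exprn_ge0// exprn_le_expR.
Qed.

End ExponentialDecay.

(** * The functional of the weight sqrt(x^2 - 1) exp(- zeta x) *)

Section BaseFunctional.
Local Open Scope classical_set_scope.
Local Open Scope ring_scope.
Context {R : realType}.
Variable zeta : R.
Hypothesis zeta_gt0 : 0 < zeta.
Implicit Types (p q : {poly R}) (x : R).
Local Notation mu := (@lebesgue_measure R).

Definition bessel_density p x : R :=
  p.[x] * Num.sqrt (x ^+ 2 - 1) * expR (- (zeta * x)).

(** Its value at the constant polynomial 1 is [K_1(zeta) / zeta], whence the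
    name. *)
Definition bessel_functional p : R :=
  \int[mu]_(x in `[1, +oo[) bessel_density p x.

Lemma continuous_bessel_density p : continuous (bessel_density p).
Proof.
have ce : continuous (fun t => expR (- (zeta * t))).
  rewrite (_ : (fun t => _) = expdecay 1 zeta); first exact: continuous_expdecay.
  by apply/funext => t; rewrite /expdecay mul1r.
move=> x; apply: cvgM; last exact: ce.
apply: cvgM; first exact: continuous_horner.
apply: continuous_comp; last exact: sqrt_continuous.
by apply: cvgB; [exact: exprn_continuous|exact: cvg_cst].
Qed.

(** Half of the exponential rate is spent on absorbing the polynomial factor;
    the square root is at most [x] and counts as one more degree. *)
Lemma bessel_density_le_expdecay p : exists C, forall x, 1 <= x ->
  `|bessel_density p x| <= expdecay C (zeta / 2) x.
Proof.
have [|C pC] := @horner_le_expR _ (p * 'X) (zeta / 2); first by rewrite divr_gt0.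
exists C => x x1; have x0 : 0 <= x := le_trans ler01 x1.
have sx : Num.sqrt (x ^+ 2 - 1) <= x.
  by rewrite -[leRHS]ger0_norm// -sqrtr_sqr ler_wsqrtr// gerBl.
rewrite /bessel_density /expdecay normrM [`|expR _|]ger0_norm ?expR_ge0//.
have -> : - (zeta / 2 * x) = zeta / 2 * x - zeta * x by field.
rewrite expRD mulrA ler_pM2r ?expR_gt0//; apply: le_trans (pC x x0).
by rewrite hornerMX !normrM ler_wpM2l// !ger0_norm// sqrtr_ge0.
Qed.

Lemma integrable_bessel_density p :
  mu.-integrable `[1, +oo[ (EFin \o bessel_density p).
Proof.
have [C pC] := bessel_density_le_expdecay p.
apply: integrable_le_expdecay pC; first by rewrite divr_gt0.
exact: continuous_bessel_density.
Qed.

Lemma bessel_functional_is_scalar : scalar bessel_functional.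
Proof.
move=> a p q; rewrite /bessel_functional.
rewrite -RintegralZl//; last exact: integrable_bessel_density.
rewrite -RintegralD//; last 2 first.
- have := integrable_bessel_density (a *: p); apply: eq_integrable => // x _.
  by rewrite /= /bessel_density hornerZ !mulrA.
- exact: integrable_bessel_density.
apply: eq_Rintegral => x _.
by rewrite /bessel_density hornerD hornerZ !mulrDl !mulrA.
Qed.

Definition bessel_scalar : {scalar {poly R}} := HB.pack bessel_functional
  (GRing.isLinear.Build _ _ _ _ _ bessel_functional_is_scalar).

(** The factor [X^2 - 1] absorbs the singularity of the derivative of the square
    root at 1, which is why the derivative is again a polynomial times the
    weight. *)
Lemma is_derive_bessel_density p x : 1 < x ->
  is_derive x 1 (bessel_density (('X^2 - 1) * p))
    (bessel_density ((('X^2 - 1) * p)^`() + 'X * p - zeta *: (('X^2 - 1) * p)) x).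
Proof.
move=> x1; set q := ('X^2 - 1) * p.
have y0 : 0 < x ^+ 2 - 1 by rewrite subr_gt0 exprn_egt1.
have Dt : is_derive x 1 (horner ('X^2 - 1 : {poly R})) ('X^2 - 1 : {poly R})^`().[x].
  exact: is_derive_poly.
have hT t : ('X^2 - 1 : {poly R}).[t] = t ^+ 2 - 1 by rewrite !hornerE.
have sT : (fun t => Num.sqrt (t ^+ 2 - 1)) = Num.sqrt \o horner ('X^2 - 1 : {poly R}).
  by apply/funext => t /=; rewrite hT.
have Ds : is_derive x 1 (fun t => Num.sqrt (t ^+ 2 - 1)) (x / Num.sqrt (x ^+ 2 - 1)).
  rewrite sT; have y0' : 0 < ('X^2 - 1 : {poly R}).[x] by rewrite hT.
  apply: is_derive_eq (is_derive1_comp (is_derive1_sqrt y0') Dt) _.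
  rewrite hT derivB derivXn derivC subr0 hornerMn hornerXn expr1 /GRing.scale /=.
  rewrite -mulr_natr; field.
  by rewrite gt_eqF// sqrtr_gt0.
have De := is_derive_expdecay 1 zeta x.
have Dp := is_derive_poly q x.
have -> : bessel_density q =
    horner q * (fun t => Num.sqrt (t ^+ 2 - 1)) * expdecay 1 zeta.
  by apply/funext => t; rewrite !fctE /bessel_density /expdecay mul1r.
apply: is_derive_eq (is_deriveM (is_deriveM Dp Ds) De) _.
rewrite /bessel_density /expdecay !fctE !mul1r /GRing.scale /=.
rewrite hornerD hornerN hornerZ hornerD [('X * p).[x]]hornerM hornerX.
have -> : q.[x] = (x ^+ 2 - 1) * p.[x] by rewrite hornerM hT.
have /ltW /sqr_sqrtr := y0; move: (sqrtr_gt0 (x ^+ 2 - 1)).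
rewrite y0; move: (Num.sqrt _) => s s0 <-; field.
by rewrite gt_eqF.
Qed.

Lemma cvg_bessel_density p : bessel_density p x @[x --> +oo] --> (0 : R).
Proof.
have [C pC] := bessel_density_le_expdecay p.
have D0 : expdecay C (zeta / 2) x @[x --> +oo] --> (0 : R).
  by apply: cvg_expdecay; rewrite divr_gt0.
have N0 : - expdecay C (zeta / 2) x @[x --> +oo] --> (0 : R).
  by rewrite -oppr0; exact: cvgN.
apply: squeeze_cvgr N0 D0; near=> x.
by rewrite -ler_norml pC//; near: x; exact: nbhs_pinfty_ge.
Unshelve. all: by end_near. Qed.

(** The integral of a derivative whose primitive vanishes at 1, because of the
    factor [X^2 - 1], and at infinity. *)
Lemma bessel_scalar_pearson p :
  bessel_scalar (('X^2 - 1) * p)^`() + bessel_scalar ('X * p)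
  = zeta * bessel_scalar (('X^2 - 1) * p).
Proof.
set q := ('X^2 - 1) * p.
have [C pC] := bessel_density_le_expdecay (q^`() + 'X * p - zeta *: q).
have : bessel_scalar (q^`() + 'X * p - zeta *: q) = - bessel_density q 1.
  apply: Rintegral_derive_le_expdecay pC _; first by rewrite divr_gt0.
  - exact: continuous_bessel_density.
  - exact: continuous_bessel_density.
  - exact: is_derive_bessel_density.
  - exact: cvg_bessel_density.
rewrite /bessel_density hornerM !hornerE expr1n subrr !mul0r oppr0.
by rewrite linearB linearD linearZ => /eqP; rewrite subr_eq0 => /eqP.
Qed.

End BaseFunctional.

(** * The functionals of the weights omega^(l) *)

Section OmegaFunctional.
Context {R : realType}.
Variable zeta : R.
Hypothesis zeta_gt0 : 0 < zeta.
Implicit Types (p q : {poly R}) (x : R).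

Definition omega_const l : R := zeta / ((2 * l%:R + 1) * besselK 2 zeta).

Definition omega_functional l p : R :=
  omega_const l * bessel_scalar zeta_gt0 (('X^2 - 1) ^+ l * p).

Lemma omega_constS l :
  (2 * l.+1%:R + 1) * omega_const l.+1 = (2 * l.+1%:R - 1) * omega_const l.
Proof.
rewrite /omega_const !invfM -[l.+1%:R]natr1; move: (besselK 2 zeta)^-1 => k.
have l0 : 0 <= l%:R :> R by [].
by field; rewrite !gt_eqF//; lra.
Qed.

Lemma omega_functional_is_scalar l : scalar (omega_functional l).
Proof.
move=> a p q; rewrite /omega_functional mulrDr -scalerAr.
by rewrite linearP mulrDr mulrCA.
Qed.

Definition omega_scalar l : {scalar {poly R}} := HB.pack (omega_functional l)
  (GRing.isLinear.Build _ _ _ _ _ (omega_functional_is_scalar l)).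

Lemma omega_half_powerE l x : 1 <= x ->
  (x ^+ 2 - 1) `^ (l%:R + 2^-1) = (x ^+ 2 - 1) ^+ l * Num.sqrt (x ^+ 2 - 1).
Proof.
move=> x1; have y0 : 0 <= x ^+ 2 - 1 by rewrite subr_ge0 exprn_ege1.
rewrite powRD ?powR_mulrn ?powR12_sqrt//; apply/implyP => /eqP.
by have : 0 <= l%:R :> R by []; lra.
Qed.

Lemma inner_omegaE l p q :
  inner_omega zeta l (horner p) (horner q) = omega_scalar l (p * q).
Proof.
rewrite /inner_omega /= /omega_functional /= /bessel_functional.
rewrite -RintegralZl//; last exact: integrable_bessel_density.
apply: eq_Rintegral => x; rewrite inE/= in_itv/= andbT => x1.
rewrite /omega omega_half_powerE// /bessel_density /omega_const !hornerM horner_exp.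
have -> : ('X^2 - 1 : {poly R}).[x] = x ^+ 2 - 1.
  by rewrite hornerD hornerN hornerXn hornerC.
ring.
Qed.

(** The pointwise relation
    [(2l + 3) omega^(l+1) = (2l + 1) (x^2 - 1) omega^(l)], integrated. *)
Lemma omega_functional_mulX2B1 l p :
  omega_scalar l.+1 p = (2 * l.+1%:R - 1) / (2 * l.+1%:R + 1)
    * omega_scalar l (('X^2 - 1) * p).
Proof.
have c0 : 2 * l.+1%:R + 1 != 0 :> R by rewrite gt_eqF// addr_gt0// mulr_gt0.
apply: (mulfI c0).
rewrite /= /omega_functional exprSr.
(* Generalized because mulrA would reassociate the product inside omega_const. *)
have := omega_constS l; move: (omega_const l) (omega_const l.+1) => w0 w1 wE.
rewrite -[_ ^+ l * _ * p]mulrA; move: (bessel_scalar _ _) => J.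
by rewrite [LHS]mulrA wE; field.
Qed.

(** The Pearson relation applied to [(X^2 - 1)^l p]. *)
Lemma omega_functional_deriv l p :
  omega_scalar l.+1 p^`() = zeta * omega_scalar l.+1 p
    - (2 * l.+1%:R - 1) * omega_scalar l ('X * p).
Proof.
rewrite /= /omega_functional.
have := bessel_scalar_pearson zeta_gt0 (('X^2 - 1) ^+ l * p).
move: (bessel_scalar zeta_gt0) => J.
rewrite mulrA -exprS.
have -> : (('X^2 - 1) ^+ l.+1 * p)^`() =
    ('X^2 - 1) ^+ l.+1 * p^`()
    + (2 * l.+1%:R) *: (('X^2 - 1) ^+ l * ('X * p)) :> {poly R}.
  rewrite derivM deriv_exp derivB derivXn derivC subr0 expr1 /=.
  rewrite -mul_polyC polyCM !polyC_natr -mulr_natl; ring.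
have -> : 'X * (('X^2 - 1) ^+ l * p) = ('X^2 - 1) ^+ l * ('X * p) by ring.
rewrite linearD linearZ /=.
set D := J (_ * p^`()); set X := J (_ * ('X * p)).
move=> pearson; have := omega_constS l.
move: (omega_const l) (omega_const l.+1) => w0 w1 wE.
rewrite [_ * (w0 * X)]mulrA -wE.
have -> : D = zeta * J (('X^2 - 1) ^+ l.+1 * p) - (2 * l.+1%:R + 1) * X.
  by rewrite -pearson; ring.
ring.
Qed.

End OmegaFunctional.

(** * The two derivative relations *)

Theorem theorem3p4 (R : realType) (zeta : R) (hzeta : 0 < zeta)
    (P : nat -> nat -> {poly R})
    (hP : forall l : nat, orthonormal_polys zeta l (P l))
    (l k : nat) (hl : (1 <= l)%N) :
  (P l.-1 k.+1)^`()
    = ((2 * l%:R - 1) / (2 * l%:R + 1) * (k.+1%:R / pt_coef P l k)) *: P l k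
      + (zeta * r_coef P l k) *: prev_poly (P l) k
  /\
  ((2 * l%:R - 1) / (2 * l%:R + 1)) *: (('X^2 - 1) * (P l k)^`())
    + (2 * l%:R - 1) *: ('X * P l k)
    = ((k + 2 * l + 1)%:R * pt_coef P l k) *: P l.-1 k.+1
      + (zeta * p_coef P l k) *: P l.-1 k.
Proof.
case: l hl => // l' _; rewrite /=.
have onP m : orthonormal (omega_scalar hzeta m) (P m).
  have [sP _ oP] := hP m; split=> // i j.
  by rewrite -inner_omegaE oP.
have b0 : 2 * l'.+1%:R - 1 != 0 :> R.
  by rewrite gt_eqF// subr_gt0 -natrM ltr1n.
have c0 : 2 * l'.+1%:R + 1 != 0 :> R by rewrite gt_eqF// addr_gt0// mulr_gt0.
have lP m i : lead_coef (P m i) != 0.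
  by have [_ /(_ i)] := hP m; rewrite lt0r => /andP[].
split.
  rewrite (deriv_ladder (omega_functional_mulX2B1 hzeta l')
    (omega_functional_deriv hzeta l') (onP l') (onP l'.+1)) /r_coef /pt_coef /=.
  congr (_ *: _ + _); field.
  by rewrite !lP nat1r b0 c0.
apply: etrans (weighted_deriv_ladder (omega_functional_mulX2B1 hzeta l')
    (omega_functional_deriv hzeta l') (onP l') (onP l'.+1) c0 k) _.
rewrite /p_coef /pt_coef /=.
congr ((_ * _) *: _ + _).
by rewrite -addnA natrD natrD natrM.
Qed.
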